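(* Let $\sigma=12\cdots(a-1)(a+1)a(a+2)(a+3)\cdots m$ where $m\geq5$ and $2\leq a\leq m-2$, let $i=\min(a,m-a)$, $u=4t/(1+t)^{2}$ and $z=(1+t)x/(1-t)$. Then (a) \[ \frac{1}{1-t}\sum_{n=0}^{\infty}P_{\sigma,n}^{\mathrm{ilpk}}(s,u)z^{n}=\sum_{n=0}^{\infty}\left(\frac{z}{1-t}+\frac{(s-1)uz^{m}}{(1-t)(1-(s-1)u\sum_{l=1}^{i}z^{m-l})}\right)^{*\langle n\rangle} \] and (b) \[ \frac{1}{1-t}\sum_{n=0}^{\infty}P_{\sigma,n}^{\mathrm{ilpk}}(u)z^{n}=\sum_{n=0}^{\infty}\left(\frac{z}{1-t}-\frac{uz^{m}}{(1-t)(1+u\sum_{l=1}^{i}z^{m-l})}\right)^{*\langle n\rangle}. \]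
   Context: $\mathfrak{S}_n$ is the set of permutations of $[n]$ in one-line notation ($\mathfrak{S}_0$ = empty permutation). The pattern $\sigma\in\mathfrak{S}_m$ is obtained from $12\cdots m$ by swapping the adjacent letters $a$ and $a+1$. $\operatorname{std}$ of a sequence of distinct integers replaces its letters by $1,2,\dots$ in order of size. For $\pi\in\mathfrak{S}_n$, $\operatorname{occ}_\sigma(\pi)$ is the number of $j\in[n-m+1]$ with $\operatorname{std}(\pi_j\cdots\pi_{j+m-1})=\sigma$. A left peak of $\pi$ is $j\in\{2,\dots,n-1\}$ with $\pi_{j-1}<\pi_j>\pi_{j+1}$, or $j=1$ if $n\ge2$ and $\pi_1>\pi_2$; $\operatorname{lpk}$ counts left peaks and $\operatorname{ilpk}(\pi)=\operatorname{lpk}(\pi^{-1})$. $P_{\sigma,n}^{\mathrm{ilpk}}(s,t)=\sum_{\pi\in\mathfrak{S}_n}s^{\operatorname{occ}_\sigma(\pi)}t^{\operatorname{ilpk}(\pi)}$ for $n\ge1$, $=1$ for $n=0$, and $P_{\sigma,n}^{\mathrm{ilpk}}(t)=P_{\sigma,n}^{\mathrm{ilpk}}(0,t)$. The right sides are computed in formal power series with ordinary multiplication in $s,x$ and the Hadamard product in $t$: $(\sum_n a_nt^n)*(\sum_n b_nt^n)=\sum_n a_nb_nt^n$; $f^{*\langle n\rangle}$ is the $n$-fold Hadamard product, $f^{*\langle0\rangle}=1/(1-t)$. Other expressions use ordinary multiplication. *)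

(* Defs.v *)
From HB Require Import structures.
From mathcomp Require Import all_boot all_order all_fingroup all_algebra.
From mathcomp Require Import boolp classical_sets.

Set Implicit Arguments.
Unset Strict Implicit.
Unset Printing Implicit Defensive.

Import GRing.Theory.

Local Open Scope ring_scope.

Record fps (R : Type) := Fps { fcoef : nat -> R }.

HB.instance Definition _ (R : Type) := gen_eqMixin (fps R).
HB.instance Definition _ (R : Type) := gen_choiceMixin (fps R).

Lemma fpsP (R : Type) (f g : fps R) : fcoef f =1 fcoef g -> f = g.
Proof. by case: f g => [f] [g] /= /funext ->. Qed.

Section FpsZmod.
Variable R : zmodType.
Implicit Types f g h : fps R.

Definition fps_zero : fps R := Fps (fun=> 0).
Definition fps_opp f : fps R := Fps (fun n => - fcoef f n).
Definition fps_add f g : fps R := Fps (fun n => fcoef f n + fcoef g n).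

Fact fps_addA : associative fps_add.
Proof. by move=> f g h; apply: fpsP => n /=; rewrite addrA. Qed.
Fact fps_addC : commutative fps_add.
Proof. by move=> f g; apply: fpsP => n /=; rewrite addrC. Qed.
Fact fps_add0 : left_id fps_zero fps_add.
Proof. by move=> f; apply: fpsP => n /=; rewrite add0r. Qed.
Fact fps_addN : left_inverse fps_zero fps_opp fps_add.
Proof. by move=> f; apply: fpsP => n /=; rewrite addNr. Qed.

HB.instance Definition _ :=
  GRing.isZmodule.Build (fps R) fps_addA fps_addC fps_add0 fps_addN.

Lemma fcoef0 n : fcoef (0 : fps R) n = 0. Proof. by []. Qed.
Lemma fcoefN f n : fcoef (- f) n = - fcoef f n. Proof. by []. Qed.
Lemma fcoefD f g n : fcoef (f + g) n = fcoef f n + fcoef g n.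
Proof. by []. Qed.

End FpsZmod.

Definition fpsC (R : nmodType) (c : R) : fps R :=
  Fps (fun n => if n == 0%N then c else 0).

Definition fpsX (R : pzSemiRingType) : fps R := Fps (fun n => (n == 1%N)%:R).

Section FpsRing.
Variable R : comNzRingType.
Implicit Types f g h : fps R.

Definition fps_mul f g : fps R :=
  Fps (fun n => \sum_(i < n.+1) fcoef f i * fcoef g (n - i)).

Definition fps_trunc N f : {poly R} := \poly_(i < N.+1) fcoef f i.

Lemma coef_fps_trunc N f i : (i <= N)%N -> (fps_trunc N f)`_i = fcoef f i.
Proof. by move=> iN; rewrite coef_poly ltnS iN. Qed.

Lemma fps_mul_trunc N f g n : (n <= N)%N ->
  fcoef (fps_mul f g) n = (fps_trunc N f * fps_trunc N g)`_n.
Proof.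
move=> nN; rewrite coefM /=; apply: eq_bigr => i _.
rewrite !coef_fps_trunc ?(leq_trans (leq_subr _ _)) //.
by rewrite (leq_trans _ nN) // leq_ord.
Qed.

Fact fps_mulC : commutative fps_mul.
Proof.
by move=> f g; apply: fpsP => n; rewrite !(@fps_mul_trunc n) // mulrC.
Qed.

Fact fps_mulA : associative fps_mul.
Proof.
move=> f g h; apply: fpsP => n.
transitivity (fps_trunc n f * (fps_trunc n g * fps_trunc n h))`_n.
  rewrite coefM /=; apply: eq_bigr => i _.
  by rewrite coef_fps_trunc 1?[(i <= n)%N]leq_ord // -(@fps_mul_trunc n) ?leq_subr.
rewrite mulrA coefM /=; apply: eq_bigr => i _.
by rewrite coef_fps_trunc ?leq_subr // -(@fps_mul_trunc n) // leq_ord.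
Qed.

Fact fps_mul1 : left_id (fpsC 1) fps_mul.
Proof.
move=> f; apply: fpsP => n /=.
rewrite big_ord_recl /= subn0 mul1r big1 ?addr0 // => i _.
by rewrite mul0r.
Qed.

Fact fps_mulDl : left_distributive fps_mul (@fps_add R).
Proof.
move=> f g h; apply: fpsP => n /=.
by rewrite -big_split /=; apply: eq_bigr => i _; rewrite mulrDl.
Qed.

Fact fps_one_neq0 : fpsC (1 : R) != 0.
Proof.
apply/eqP => /(congr1 (fun f => fcoef f 0)) /= /eqP.
by rewrite oner_eq0.
Qed.

HB.instance Definition _ := GRing.Zmodule_isComNzRing.Build (fps R)
  fps_mulA fps_mulC fps_mul1 fps_mulDl fps_one_neq0.

Lemma fcoef1 n : fcoef (1 : fps R) n = (n == 0%N)%:R.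
Proof. by case: n. Qed.
Lemma fcoefM f g n :
  fcoef (f * g) n = \sum_(i < n.+1) fcoef f i * fcoef g (n - i).
Proof. by []. Qed.

End FpsRing.

Section FpsUnitRing.
Variable R : comUnitRingType.
Implicit Types f g h : fps R.

Definition fps_unit : {pred fps R} := fun f => fcoef f 0 \is a GRing.unit.

(* coefficients 0, ..., n of the inverse of f, by the usual recursion *)
Fixpoint fps_invs f n : seq R :=
  if n is p.+1 then
    let l := fps_invs f p in
    rcons l (- (fcoef f 0)^-1 * \sum_(i < p.+1) fcoef f i.+1 * l`_(p - i))
  else [:: (fcoef f 0)^-1].

Definition fps_inv f : fps R :=
  if f \in fps_unit then Fps (fun n => (fps_invs f n)`_n) else f.

Lemma size_fps_invs f n : size (fps_invs f n) = n.+1.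
Proof. by elim: n => //= n IH; rewrite size_rcons IH. Qed.

Lemma nth_fps_invs f n k :
  (k <= n)%N -> (fps_invs f n)`_k = (fps_invs f k)`_k.
Proof.
elim: n => [|n IH]; first by case: k.
rewrite leq_eqVlt => /predU1P[-> //|]; rewrite ltnS => kn.
by rewrite /= nth_rcons size_fps_invs ltnS kn IH.
Qed.

Fact fps_mulVx : {in fps_unit, left_inverse 1 fps_inv *%R}.
Proof.
move=> f uf; rewrite mulrC /fps_inv uf; apply: fpsP => n.
rewrite fcoefM fcoef1 /=; case: n => [|n].
  by rewrite big_ord_recl big_ord0 addr0 /= mulrV.
rewrite big_ord_recl /= nth_rcons size_fps_invs ltnn eqxx.
rewrite mulrA mulrN mulrV // mulN1r.
apply/eqP; rewrite addrC subr_eq0; apply/eqP; apply: eq_bigr => i _.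
by rewrite subSS [in RHS]nth_fps_invs // leq_subr.
Qed.

Fact fps_unitPl f g : g * f = 1 -> fps_unit f.
Proof.
move=> /(congr1 (fun h => fcoef h 0)); rewrite fcoefM fcoef1.
rewrite big_ord_recl big_ord0 addr0 /= => gf; apply/unitrP.
by exists (fcoef g 0); rewrite gf mulrC gf.
Qed.

Fact fps_inv_out : {in [predC fps_unit], fps_inv =1 id}.
Proof. by move=> f; rewrite inE /= /fps_inv => /negbTE ->. Qed.

HB.instance Definition _ := GRing.ComNzRing_hasMulInverse.Build (fps R)
  fps_mulVx fps_unitPl fps_inv_out.

Lemma fps_unitE f : (f \is a GRing.unit) = (fcoef f 0 \is a GRing.unit).
Proof. by []. Qed.

End FpsUnitRing.

(* Power series in x and t, as R[[x]][[t]]: t is the outer variable, so that  *)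
(* the Hadamard product in t is the coefficientwise product over R[[x]]        *)

Definition hadamard (A : pzSemiRingType) (f g : fps A) : fps A :=
  Fps (fun n => fcoef f n * fcoef g n).

Definition hadamard_pow (A : comUnitRingType) (f : fps A) (n : nat) : fps A :=
  iter n (hadamard f) (1 - fpsX A)^-1.

Section BivariateSeries.
Variable R : comUnitRingType.

Local Notation xtser := (fps (fps R)).

Definition xs : xtser := fpsC (fpsX R).
Definition ts : xtser := fpsX (fps R).
Definition scal (c : R) : xtser := fpsC (fpsC c).

Definition us : xtser := 4%:R * ts / (1 + ts) ^+ 2.
Definition zs : xtser := (1 + ts) * xs / (1 - ts).

(* The denominators below are units, so that / is a genuine division. *)
Lemma fcoefM0 (A : comNzRingType) (f g : fps A) :
  fcoef (f * g) 0 = fcoef f 0 * fcoef g 0.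
Proof. by rewrite fcoefM big_ord_recl big_ord0 addr0. Qed.

Lemma unit_1Bts : 1 - ts \is a GRing.unit.
Proof. by rewrite fps_unitE fcoefD fcoefN fcoef1 /= subr0 unitr1. Qed.

Lemma unit_1Dts : 1 + ts \is a GRing.unit.
Proof. by rewrite fps_unitE fcoefD fcoef1 /= addr0 unitr1. Qed.

Lemma unit_1Dus (f g : xtser) : 1 + f * us * g \is a GRing.unit.
Proof.
rewrite fps_unitE fcoefD fcoef1 /us !(fcoefM0, mulrA) /=.
by rewrite mulr0 !mul0r addr0 unitr1.
Qed.

(* convergence of an infinite series: each coefficient of the partial sums is *)
(* eventually constant                                                        *)
Definition has_sum (F : nat -> xtser) (S : xtser) : Prop :=
  forall j k : nat, exists N : nat, forall n : nat, (N <= n)%N ->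
    fcoef (fcoef (\sum_(0 <= l < n) F l) j) k = fcoef (fcoef S j) k.

Definition summable (F : nat -> xtser) : Prop := exists S, has_sum F S.

Definition infsum (F : nat -> xtser) : xtser := xget 0 [set S | has_sum F S]%classic.

Lemma has_sum_unique F S S' : has_sum F S -> has_sum F S' -> S = S'.
Proof.
move=> h h'; apply: fpsP => j; apply: fpsP => k.
have [[N hN] [N' hN']] := (h j k, h' j k).
by rewrite -(hN (maxn N N')) ?leq_maxl // hN' // leq_maxr.
Qed.

Lemma infsumE F S : has_sum F S -> infsum F = S.
Proof.
move=> h; apply: (@has_sum_unique F) => //.
by apply: (@xgetPex _ 0 [set S | has_sum F S]%classic); exists S.
Qed.

End BivariateSeries.

(* one-line notation, with letters in {1, ..., n} *)
Definition oneline (n : nat) (p : 'S_n) : seq nat :=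
  [seq (p i).+1 | i <- enum 'I_n].

(* for a word with distinct letters, x becomes its rank, counted from 1 *)
Definition std (w : seq nat) : seq nat :=
  [seq count (fun y => (y <= x)%N) w | x <- w].

(* starting positions are counted from 0; there is none if |sigma| > |w| *)
Definition occ (sigma w : seq nat) : nat :=
  count (fun j => std (take (size sigma) (drop j w)) == sigma)
        (iota 0 ((size w).+1 - size sigma)).

Definition letter (w : seq nat) (j : nat) : nat := nth 0%N w j.-1.

Definition left_peak (w : seq nat) (j : nat) : bool :=
  [&& (2 <= j)%N, (j <= (size w).-1)%N,
      (letter w j.-1 < letter w j)%N & (letter w j > letter w j.+1)%N]
  || [&& j == 1%N, (2 <= size w)%N & (letter w 1 > letter w 2)%N].

Definition lpk (w : seq nat) : nat := count (left_peak w) (iota 1 (size w)).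

Definition ilpk (n : nat) (p : 'S_n) : nat := lpk (oneline p^-1%g).

(* the polynomial P_{sigma,n}^{ilpk}, evaluated at elements s, t of a ring *)
Definition P_ilpk (A : comNzRingType) (sigma : seq nat) (n : nat) (s t : A) : A :=
  if n == 0%N then 1
  else \sum_(p : 'S_n) s ^+ occ sigma (oneline p) * t ^+ ilpk p.

Definition P0_ilpk (A : comNzRingType) (sigma : seq nat) (n : nat) (t : A) : A :=
  P_ilpk sigma n 0 t.

(* 1 2 ... (a-1) (a+1) a (a+2) (a+3) ... m *)
Definition transp_pattern (m a : nat) : seq nat :=
  iota 1 a.-1 ++ [:: a.+1; a] ++ iota a.+2 (m - a.+1).

(* Main.v *)
(* Fix k. The coefficient of t^k in ((1+t)/(1-t))^n u^ilpk(pi) / (1-t) counts *)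
(* the words of length n over {0, ..., 2k} whose standardization is pi, where *)
(* equal even letters are ranked from left to right and equal odd letters     *)
(* from right to left: a word standardizing to pi is a weakly increasing      *)
(* sequence in which equality at j is allowed only for even letters if j is   *)
(* an ascent of pi^-1 and only for odd ones if it is a descent, and such      *)
(* sequences are counted by a transfer matrix. So the coefficient of t^k on   *)
(* the left is the generating function W of words by length and occurrences   *)
(* of sigma in the standardization. Occurrences of sigma overlap in l <=      *)
(* min(a, m - a) letters, and a chain of r overlapping occurrences forces the *)
(* standardization to be the identity with r disjoint adjacent letters        *)
(* swapped: an involution with r left peaks. The Goulden-Jackson argument     *)
(* then gives W = 1 / (1 - C), where C is the coefficient of t^k of the       *)
(* series in parentheses, and 1 / (1 - C) is also the coefficient of t^k of   *)
(* the sum of its Hadamard powers.                                            *)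
Require Import Defs.
From HB Require Import structures.
From mathcomp Require Import all_boot all_order all_fingroup all_algebra.
From mathcomp Require Import zify ring.

Set Implicit Arguments.
Unset Strict Implicit.
Unset Printing Implicit Defensive.

Import GRing.Theory.
Local Open Scope ring_scope.

(** * Power series *)

(** Everything is compared at the coefficient of t^k, over words on 2k+1 letters. By [walks_evenE]
    and [fcoef_nwords], a permutation contributes the number of words standardizing to it. Each word
    has exactly one standardization ([sum_sorted_image_word]), so the left side becomes
    [word_ser k], the series W of words weighted by c^occurrences ([fcoef_P_ilpk]).

    Expanding c^occ as (1 + (c-1))^occ marks some occurrences, each with weight c-1. Overlapping
    marked occurrences form clusters: [occ0_overlap] limits the shifts, and [extend_sorted] turns a
    cluster into sortedness along one list of positions, so the words carrying it are again counted
    by [nwords]. A further occurrence at shift d multiplies the contribution by (s-1) u z^d, whence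
    the geometric form of [cluster_ser] ([cluster_sumE]).

    Removing the first letter or the first cluster gives W = 1 + C W ([word_ser_rec]). As Hadamard
    powers are coefficientwise powers, the right side is also 1/(1-C) at t^k ([xsum_hadamard]). *)

Section FpsFacts.
Variable R : comNzRingType.
Implicit Types (f g : fps R) (c : R).

Lemma fcoef_sum (I : Type) (r : seq I) (P : pred I) (F : I -> fps R) n :
  fcoef (\sum_(i <- r | P i) F i) n = \sum_(i <- r | P i) fcoef (F i) n.
Proof. by elim/big_rec2: _ => // i y1 y2 _ <-. Qed.

Lemma fcoefCM c f n : fcoef (fpsC c * f) n = c * fcoef f n.
Proof.
by rewrite fcoefM big_ord_recl subn0 big1 ?addr0 // => i _; rewrite mul0r.
Qed.

Fact fpsC_is_zmod_morphism : zmod_morphism (@fpsC R).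
Proof. by move=> c d; apply: fpsP => -[|n] //=; rewrite subr0. Qed.

Fact fpsC_is_monoid_morphism : monoid_morphism (@fpsC R).
Proof.
by split=> // c d; apply: fpsP => n; rewrite fcoefCM; case: n => //= n; rewrite mulr0.
Qed.

HB.instance Definition _ :=
  GRing.isZmodMorphism.Build R (fps R) (@fpsC R) fpsC_is_zmod_morphism.
HB.instance Definition _ :=
  GRing.isMonoidMorphism.Build R (fps R) (@fpsC R) fpsC_is_monoid_morphism.

Lemma fcoefXM f n : fcoef (fpsX R * f) n = if n is p.+1 then fcoef f p else 0.
Proof.
rewrite fcoefM big_ord_recl mul0r add0r; case: n => [|n]; first by rewrite big_ord0.
rewrite big_ord_recl mul1r subSS subn0 big1 ?addr0 // => i _.
by rewrite /= mul0r.
Qed.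

Lemma fcoefXnM f N n :
  fcoef (fpsX R ^+ N * f) n = if (n < N)%N then 0 else fcoef f (n - N).
Proof.
elim: N n => [|N IH] n; first by rewrite mul1r subn0.
by rewrite exprS -mulrA fcoefXM; case: n => // n; rewrite IH ltnS subSS.
Qed.

End FpsFacts.

(** * Counting words with prescribed steps *)

Section Transfer.
Local Open Scope nat_scope.

Definition step (b : bool) (c d : nat) : bool :=
  (c < d) || (c == d) && (odd c != b).

(* The number of words ending with c whose letters, after a virtual letter 0, *)
(* make the steps allowed by the flags fl (true for an ascent), listed from   *)
(* the last one to the first one.                                             *)
Fixpoint walks (fl : seq bool) (c : nat) : nat :=
  if fl is b :: fl' then \sum_(d < c.+1 | step b d c) walks fl' d else c == 0.

#[global] Arguments walks : simpl never.

Lemma walks_true fl c : walks (true :: fl) c = \sum_(d < c + ~~ odd c) walks fl d.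
Proof.
rewrite /walks -/walks; case: (boolP (odd c)) => oc.
  rewrite addn0 big_mkcond big_ord_recr /= /step ltnn eqxx oc addn0.
  by apply: eq_bigr => d _; rewrite ltn_ord.
rewrite addn1; apply: eq_bigl => d; rewrite /step.
by have := ltn_ord d; rewrite ltnS; case: ltngtP => //= -> _; rewrite ?(negbTE oc) ?oc.
Qed.

Lemma walks_false fl c : walks (false :: fl) c = \sum_(d < c + odd c) walks fl d.
Proof.
rewrite /walks -/walks; case: (boolP (odd c)) => oc; last first.
  rewrite addn0 big_mkcond big_ord_recr /= /step ltnn eqxx (negbTE oc) addn0.
  by apply: eq_bigr => d _; rewrite ltn_ord.
rewrite addn1; apply: eq_bigl => d; rewrite /step.
by have := ltn_ord d; rewrite ltnS; case: ltngtP => //= -> _; rewrite ?(negbTE oc) ?oc.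
Qed.

End Transfer.

(* As in walks, flags are listed from the last one to the first one. *)
Fixpoint peaks (fl : seq bool) : nat :=
  if fl is b :: fl' then ((~~ b && head false fl') + peaks fl')%N else 0%N.

(** * The transfer matrix in generating functions *)

Section TransferSeries.
Variable A : comUnitRingType.
Notation t := (fpsX A).

(** The last letter ranges up to the even letter 2k, or only up to the odd letter 2k-1.
    Multiplication by [1 - t] isolates the top two letters, where [walks_true] and [walks_false]
    give sums of these same two kinds. *)
Definition walks_even fl : fps A := Fps (fun k => (\sum_(c < k.*2.+1) walks fl c)%N%:R).
Definition walks_odd fl : fps A := Fps (fun k => (\sum_(c < k.*2) walks fl c)%N%:R).

Definition letter_ser : fps A := (1 + t) / (1 - t).
Definition peak_ser : fps A := 4%:R * t / (1 + t) ^+ 2.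

Lemma unit_1BX : 1 - t \is a GRing.unit.
Proof. by rewrite fps_unitE fcoefD fcoefN fcoef1 /= subr0 unitr1. Qed.

Lemma unit_1DX : 1 + t \is a GRing.unit.
Proof. by rewrite fps_unitE fcoefD fcoef1 /= addr0 unitr1. Qed.


Lemma walks_even_true fl : (1 - t) * walks_even (true :: fl) = (1 + t) * walks_even fl.
Proof.
apply: fpsP => k; rewrite mulrBl mulrDl !mul1r !fcoefD fcoefN !fcoefXM.
case: k => [|k]; rewrite [LHS]/= [RHS]/=.
  rewrite subr0 addr0; congr (_ %:R).
  rewrite !big_ord_recl !big_ord0.
  by rewrite walks_true /= big_ord_recl big_ord0 !addn0.
apply/eqP; rewrite subr_eq; apply/eqP; rewrite -!natrD doubleS.
rewrite [in LHS]big_ord_recr [in LHS]big_ord_recr /= !walks_true /= odd_double.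
by congr (_ %:R); rewrite addn0 addn1 /=; lia.
Qed.

Lemma walks_even_false fl : (1 - t) * walks_even (false :: fl) = 2%:R * walks_odd fl.
Proof.
apply: fpsP => k; rewrite mulrBl mul1r mulr_natl mulr2n !fcoefD fcoefN !fcoefXM.
case: k => [|k]; rewrite [LHS]/= [RHS]/=.
  by rewrite subr0 -natrD !big_ord_recl !big_ord0 walks_false /= big_ord0.
apply/eqP; rewrite subr_eq; apply/eqP; rewrite -!natrD doubleS.
rewrite [in LHS]big_ord_recr [in LHS]big_ord_recr /= !walks_false /= odd_double.
by congr (_ %:R); rewrite addn0 addn1 /=; lia.
Qed.

Lemma walks_odd_true fl : walks_odd (true :: fl) = walks_even (true :: fl) - walks_even fl.
Proof.
apply: fpsP => k; apply/esym/eqP; rewrite fcoefD fcoefN subr_eq /= -natrD.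
by rewrite big_ord_recr /= walks_true odd_double addn1.
Qed.

Lemma walks_odd_false fl : walks_odd (false :: fl) = walks_even (false :: fl) - walks_odd fl.
Proof.
apply: fpsP => k; apply/esym/eqP; rewrite fcoefD fcoefN subr_eq /= -natrD.
by rewrite big_ord_recr /= walks_false odd_double addn0.
Qed.

Lemma walks_even_nil : (1 - t) * walks_even [::] = 1.
Proof.
apply: fpsP => k; rewrite mulrBl mul1r fcoefD fcoefN fcoefXM fcoef1.
have E n : (\sum_(c < n.+1) walks [::] c)%N = 1%N.
  by rewrite big_ord_recl big1.
by case: k => [|k]; rewrite /= !E ?subr0 // subrr.
Qed.

Lemma walks_evenE fl :
  walks_even (rcons fl true) = letter_ser ^+ (size fl).+1 * peak_ser ^+ peaks (rcons fl true) / (1 - t).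
Proof.
(* The induction also carries the ratio of the odd to the even sum: 2t/(1+t) after an ascent,
   (1+t)/2 after a descent. A descent brings in twice the odd sum, so it yields the extra factor
   [peak_ser] exactly after an ascent. The default [true] of [head] stands for the initial flag. *)
suff [] : walks_even (rcons fl true) =
     letter_ser ^+ (size fl).+1 * peak_ser ^+ peaks (rcons fl true) / (1 - t) /\
   (if head true fl then (1 + t) * walks_odd (rcons fl true) = 2%:R * t * walks_even (rcons fl true)
    else 2%:R * walks_odd (rcons fl true) = (1 + t) * walks_even (rcons fl true)) by [].
have uB := unit_1BX; have uD := unit_1DX.
have Ey : (1 - t) * letter_ser = 1 + t by rewrite /letter_ser mulrC divrK.
have Eu : (1 + t) ^+ 2 * peak_ser = 4%:R * t by rewrite /peak_ser mulrC divrK // unitrX.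
have base fl' : (1 + t) * walks_odd (true :: fl') = 2%:R * t * walks_even (true :: fl').
  apply: (mulrI uB); rewrite walks_odd_true mulrCA mulrBr walks_even_true.
  rewrite [RHS]mulrCA walks_even_true; ring.
elim: fl => [|b fl [IHa IHb]].
  split; last exact: base.
  apply: (mulrI uB); rewrite /= walks_even_true [RHS]mulrC divrK // expr1 mulr1.
  apply: (mulrI uB); rewrite mulrCA walks_even_nil mulr1 Ey //.
rewrite rcons_cons; case: b.
  split; last exact: base.
  apply: (mulrI uB); rewrite walks_even_true IHa [size _]/= [in RHS]exprS /= add0n -Ey; ring.
have Hh : head true fl = head false (rcons fl true) by case: (fl).
have Hb : 2%:R * walks_odd (false :: rcons fl true) = (1 + t) * walks_even (false :: rcons fl true).
  rewrite walks_odd_false mulrBr -walks_even_false; ring.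
split; last exact: Hb.
apply: (mulrI uB); rewrite walks_even_false.
rewrite [size _]/= exprS [peaks _]/= -Hh exprD.
case: (head true fl) IHb => IHb /=; last first.
  by rewrite IHb IHa mul1r -Ey; ring.
apply: (mulrI uD); rewrite mulrCA IHb IHa expr1.
set Y := letter_ser ^+ _; set U := peak_ser ^+ _; set J := (1 - t)^-1.
transitivity ((1 + t) * ((1 - t) * letter_ser) * peak_ser * (Y * U * J)); last by ring.
by rewrite Ey -expr2 Eu; ring.
Qed.

End TransferSeries.

(** * Words and standardization *)

Definition image_word n (p : 'S_n) : seq nat := [seq val (p i) | i <- enum 'I_n].

Section ImageWords.
Variable n : nat.
Implicit Types p : 'S_n.

Lemma nth_image_word p (i : 'I_n) : nth 0%N (image_word p) i = p i.
Proof. by rewrite (nth_map i) ?size_enum_ord // nth_ord_enum. Qed.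

Lemma size_image_word p : size (image_word p) = n.
Proof. by rewrite size_map size_enum_ord. Qed.

Lemma uniq_image_word p : uniq (image_word p).
Proof. by rewrite map_inj_uniq ?enum_uniq // => i j /val_inj /perm_inj. Qed.

Lemma perm_image_word p : perm_eq (image_word p) (iota 0 n).
Proof.
rewrite uniq_perm ?uniq_image_word ?iota_uniq // => j; rewrite mem_iota add0n /=.
apply/mapP/idP => [[i _ ->] | jn]; first exact: ltn_ord.
exists (p^-1%g (Ordinal jn)).
  by rewrite mem_enum.
by rewrite permKV.
Qed.

Lemma image_word_inj : injective (@image_word n).
Proof.
move=> p q pq; apply/permP => i; apply: val_inj.
by rewrite /= -!nth_image_word pq.
Qed.

Lemma image_wordP rho : perm_eq rho (iota 0 n) -> exists p, image_word p = rho.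
Proof.
move=> rhoP; have sz_rho : size rho = n by rewrite (perm_size rhoP) size_iota.
have rho_lt (i : 'I_n) : (nth 0%N rho i < n)%N.
  have : nth 0%N rho i \in iota 0 n by rewrite -(perm_mem rhoP) mem_nth ?sz_rho.
  by rewrite mem_iota.
have urho : uniq rho by rewrite (perm_uniq rhoP) iota_uniq.
have s_inj : injective (fun i => Ordinal (rho_lt i)).
  move=> i j /(congr1 val) /= /eqP; rewrite nth_uniq ?sz_rho // => /eqP.
  exact: val_inj.
exists (perm s_inj); apply: (@eq_from_nth _ 0%N); first by rewrite size_image_word.
by move=> i; rewrite size_image_word => ilt; rewrite (nth_image_word _ (Ordinal ilt)) permE.
Qed.

End ImageWords.

Section WordSums.
Variables (R : comNzRingType) (K : nat).
Implicit Types (f g : seq nat -> R) (w u v : seq nat).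

Definition wsum n f : R := \sum_(w : n.-tuple 'I_K) f [seq val x | x <- w].

Lemma eq_wsum n f g : (forall w, size w = n -> f w = g w) -> wsum n f = wsum n g.
Proof. by move=> fg; apply: eq_bigr => w _; rewrite fg // size_map size_tuple. Qed.

Lemma wsum0 f : wsum 0 f = f [::].
Proof.
rewrite /wsum (big_pred1 [tuple]) // => w.
by apply/esym/eqP; exact: tuple0.
Qed.

Lemma wsumS n f : wsum n.+1 f = \sum_(c < K) wsum n (fun w => f (val c :: w)).
Proof.
rewrite /wsum pair_bigA /=.
rewrite (reindex (fun p : 'I_K * n.-tuple 'I_K => [tuple of p.1 :: p.2])) //.
exists (fun w : n.+1.-tuple 'I_K => (thead w, [tuple of behead w])) => [[c w] _|w _].
  by rewrite /= theadE; congr pair; apply: val_inj.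
by rewrite [RHS]tuple_eta; apply: val_inj.
Qed.

Lemma wsumD n f g : wsum n (fun w => f w + g w) = wsum n f + wsum n g.
Proof. exact: big_split. Qed.

Lemma wsumZ n c f : wsum n (fun w => c * f w) = c * wsum n f.
Proof. by rewrite /wsum mulr_sumr. Qed.

Lemma wsum_sum n (I : Type) (r : seq I) (P : pred I) (F : I -> seq nat -> R) :
  wsum n (fun w => \sum_(i <- r | P i) F i w) = \sum_(i <- r | P i) wsum n (F i).
Proof. exact: exchange_big. Qed.

Lemma wsum_cat m n f :
  wsum (m + n) f = wsum m (fun u => wsum n (fun v => f (u ++ v))).
Proof.
elim: m f => [|m IH] f; first by rewrite wsum0.
by rewrite addSn !wsumS; apply: eq_bigr => c _; rewrite IH.
Qed.

Lemma wsum_rcons n f : wsum n.+1 f = wsum n (fun u => \sum_(c < K) f (rcons u c)).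
Proof.
rewrite -addn1 wsum_cat; apply: eq_wsum => u _; rewrite wsumS.
by apply: eq_bigr => c _; rewrite wsum0 cats1.
Qed.

Lemma wsum_perm n rho f : perm_eq rho (iota 0 n) ->
  wsum n (fun w => f [seq nth 0%N w p | p <- rho]) = wsum n f.
Proof.
case/image_wordP => p <-.
pose h (w : n.-tuple 'I_K) := [tuple tnth w (p i) | i < n].
have h_inj : injective h.
  move=> w w' hw; apply: eq_from_tnth => i.
  have := congr1 (fun x : n.-tuple 'I_K => tnth x (p^-1%g i)) hw.
  by rewrite !tnth_mktuple permKV.
rewrite /wsum [RHS](reindex_inj h_inj); apply: eq_bigr => w _; congr f.
rewrite /image_word -!map_comp; apply: eq_map => i /=.
by rewrite (nth_map (tnth w i)) ?size_tuple // -tnth_nth.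
Qed.

End WordSums.

(* The standardization order on the positions of a word: equal even letters   *)
(* increase from left to right, equal odd letters from right to left.         *)
Definition prec (w : seq nat) (p q : nat) : bool :=
  let c := nth 0%N w p in let d := nth 0%N w q in
  (c < d)%N || (c == d) && (if odd c then q < p else p < q)%N.

Fixpoint walk (c : nat) (fl : seq bool) (v : seq nat) : bool :=
  match fl, v with
  | b :: fl', d :: v' => step b c d && walk d fl' v'
  | [::], [::] => true
  | _, _ => false
  end.

(** The virtual 0 in front makes the first flag an ascent; since the letter 0 is even, it allows
    every first letter. *)
Definition flags (rho : seq nat) : seq bool := pairmap leq 0%N rho.

Definition nwords (K : nat) (rho : seq nat) : nat :=
  (\sum_(c < K) walks (rev (flags rho)) c)%N.

Section Precedence.
Local Open Scope nat_scope.
Implicit Types (w v rho : seq nat).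

Lemma prec_step w p q : p != q -> prec w p q = step (p <= q) (nth 0 w p) (nth 0 w q).
Proof.
move=> pq; rewrite /prec /step; congr (_ || _ && _).
by case: (odd _); case: (ltngtP p q) pq.
Qed.

Lemma prec_irr w : irreflexive (prec w).
Proof. by move=> p; rewrite /prec !ltnn if_same andbF. Qed.

Lemma prec_trans w : transitive (prec w).
Proof.
move=> q p r; rewrite /prec.
move: (nth 0 w p) (nth 0 w q) (nth 0 w r) => c d e.
case/orP=> [cd|/andP[/eqP <- pq]]; case/orP=> [de|/andP[/eqP <- qr]].
- by rewrite (ltn_trans cd de).
- by rewrite cd.
- by rewrite de.
rewrite eqxx; case: (odd c) pq qr => pq qr; apply/orP; right.
  exact: ltn_trans qr pq.
exact: ltn_trans pq qr.
Qed.

Lemma prec_total w p q : p != q -> prec w p q || prec w q p.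
Proof.
rewrite /prec eq_sym => pq.
by case: (ltngtP (nth 0 w p)) => //= ->; case: (odd _); case: (ltngtP p q) pq.
Qed.

Lemma path_prec w x rho : uniq (x :: rho) ->
  path (prec w) x rho = walk (nth 0 w x) (pairmap leq x rho) [seq nth 0 w p | p <- rho].
Proof.
elim: rho x => //= y rho IH x /and3P[xy yrho urho].
rewrite IH /= ?yrho // prec_step //.
by apply: contraNneq xy => ->; rewrite mem_head.
Qed.

Lemma sorted_prec w rho : uniq rho ->
  sorted (prec w) rho = walk 0 (flags rho) [seq nth 0 w p | p <- rho].
Proof.
case: rho => //= x rho urho; rewrite path_prec // /step.
by case: (nth 0 w x).
Qed.

Lemma walk_rcons c fl v b d : size fl = size v ->
  walk c (rcons fl b) (rcons v d) = walk c fl v && step b (last c v) d.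
Proof.
elim: fl v c => [|b' fl IH] [|d' v] c //= => [_|[sz]]; first by rewrite andbT.
by rewrite IH // andbA.
Qed.

End Precedence.

(** The weight [h] of the last letter makes the induction close: it absorbs one step of the transfer
    matrix. *)
Lemma wsum_walk (R : comNzRingType) K (fl : seq bool) (h : nat -> R) : (0 < K)%N ->
  wsum K (size fl) (fun v => (walk 0 fl v)%:R * h (last 0%N v)) =
  \sum_(c < K) (walks (rev fl) c)%:R * h c.
Proof.
move=> K0; elim/last_ind: fl h => [|fl b IH] h.
  rewrite wsum0 /= mul1r; case: K K0 => // K _.
  by rewrite big_ord_recl big1 ?addr0 ?mul1r // => i _; rewrite mul0r.
rewrite size_rcons wsum_rcons.
transitivity (wsum K (size fl) (fun v => (walk 0 fl v)%:R *
   (\sum_(c < K) (step b (last 0%N v) c)%:R * h c))).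
  apply: eq_wsum => v szv; rewrite mulr_sumr; apply: eq_bigr => c _.
  by rewrite last_rcons walk_rcons // mulrA -natrM mulnb.
rewrite (IH (fun d => \sum_(c < K) (step b d c)%:R * h c)).
under eq_bigr => c _ do rewrite mulr_sumr.
rewrite exchange_big; apply: eq_bigr => c _ /=.
under eq_bigr => d _ do rewrite mulrA -natrM.
rewrite -mulr_suml -natr_sum; congr (_%:R * _).
rewrite rev_rcons /walks -/walks [RHS]big_mkcond.
rewrite (eq_bigr (fun d : 'I_K => if step b d c then walks (rev fl) d else 0%N)); last first.
  by move=> d _; case: (step b d c); rewrite ?muln1 ?muln0.
rewrite [RHS](big_ord_widen K (fun d => if step b d c then walks (rev fl) d else 0%N)) //.
rewrite [RHS]big_mkcond; apply: eq_bigr => d _.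
by rewrite ltnS /step; case: ltngtP.
Qed.

Lemma wsum_sorted (R : comNzRingType) K n rho : (0 < K)%N -> perm_eq rho (iota 0 n) ->
  wsum K n (fun w => (sorted (prec w) rho)%:R) = (nwords K rho)%:R :> R.
Proof.
move=> K0 rhoP; have urho : uniq rho by rewrite (perm_uniq rhoP) iota_uniq.
transitivity (wsum K n (fun w => (walk 0 (flags rho) [seq nth 0%N w p | p <- rho])%:R : R)).
  by apply: eq_wsum => w _; rewrite sorted_prec.
rewrite (wsum_perm K (fun v => (walk 0 (flags rho) v)%:R) rhoP).
have := wsum_walk (flags rho) (fun=> 1 : R) K0.
rewrite /flags size_pairmap (perm_size rhoP) size_iota /nwords natr_sum => E.
rewrite -[LHS]mulr1 -(eq_bigr _ (fun i _ => mulr1 _)) -E.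
by rewrite mulr1; apply: eq_wsum => w _; rewrite mulr1.
Qed.

Lemma fcoef_nwords (A : comUnitRingType) k rho :
  fcoef (letter_ser A ^+ size rho * peak_ser A ^+ peaks (rev (flags rho)) / (1 - fpsX A)) k =
  (nwords k.*2.+1 rho)%:R.
Proof.
case: rho => [|x rho].
  transitivity (fcoef (walks_even A [::]) k) => //; congr (fcoef _ k).
  by apply: (mulrI (unit_1BX A)); rewrite walks_even_nil !mul1r mulrV ?unit_1BX.
have -> : rev (flags (x :: rho)) = rcons (rev (pairmap leq x rho)) true.
  by rewrite /flags /= rev_cons leq0n.
have -> : size (x :: rho) = (size (rev (pairmap leq x rho))).+1.
  by rewrite size_rev size_pairmap.
by rewrite -walks_evenE /nwords /flags /= rev_cons leq0n.
Qed.

(** * Occurrences in permutations and in words *)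

Section Patterns.
Local Open Scope nat_scope.

Lemma count_leq_sorted s i : sorted ltn s -> i < size s ->
  count (fun y => y <= nth 0 s i) s = i.+1.
Proof.
elim: s i => //= x s IH i; rewrite path_sortedE; last exact: ltn_trans.
case/andP=> xs ss; case: i => [|i] lti /=.
  rewrite leqnn; congr _.+1; apply/eqP; rewrite -leqn0 leqNgt -has_count.
  by apply/hasPn => y /(allP xs) /= xy; rewrite -ltnNge.
by rewrite IH // ltnW //; apply: (allP xs); apply: mem_nth.
Qed.

(* The positions (from 0) of the letters 1, ..., m of transp_pattern m a. *)
Definition positions (m a : nat) : seq nat :=
  iota 0 a.-1 ++ [:: a; a.-1] ++ iota a.+1 (m - a.+1).

Variables m a : nat.
Hypotheses (a_gt0 : 0 < a) (a_lt : a < m).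
Notation sigma := (transp_pattern m a).
Notation tau := (positions m a).

Lemma perm_positions : perm_eq tau (iota 0 m).
Proof.
have -> : iota 0 m = iota 0 a.-1 ++ [:: a.-1; a] ++ iota a.+1 (m - a.+1).
  have E : m = a.-1 + (2 + (m - a.+1)) by lia.
  rewrite [in LHS]E !iotaD /= add0n.
  by congr (_ ++ [:: _, _ & iota _ _]); lia.
by rewrite perm_cat2l perm_cat2r; apply/seq.permP => P; rewrite /= !addn0 addnC.
Qed.

Lemma size_positions : size tau = m.
Proof. by rewrite (perm_size perm_positions) size_iota. Qed.

Lemma mem_positions p : (p \in tau) = (p < m).
Proof. by rewrite (perm_mem perm_positions) mem_iota. Qed.

Lemma size_transp_pattern : size sigma = m.
Proof. rewrite /transp_pattern !size_cat !size_iota /=; lia. Qed.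

Lemma transp_pattern_positions : [seq nth 0 sigma p | p <- tau] = iota 1 m.
Proof.
have E : m = a.-1 + (2 + (m - a.+1)) by lia.
rewrite !map_cat [in RHS]E !iotaD; congr (_ ++ _).
  apply: (@eq_from_nth _ 0); rewrite size_map !size_iota // => k klt.
  by rewrite (nth_map 0) ?size_iota // !nth_iota // add0n nth_cat size_iota klt nth_iota.
have nthl k : nth 0 sigma (a.-1 + k) = nth 0 ([:: a.+1; a] ++ iota a.+2 (m - a.+1)) k.
  by rewrite [LHS]nth_cat size_iota ltnNge leq_addr /= addKn.
congr (_ ++ _).
  have := (nthl 0, nthl 1); rewrite addn0 addn1 prednK //= => -[-> ->].
  by congr [:: _; _]; lia.
apply: (@eq_from_nth _ 0); first by rewrite size_map !size_iota.
move=> i; rewrite size_map size_iota => lti.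
rewrite (nth_map 0) ?size_iota // !nth_iota //.
have -> : a.+1 + i = a.-1 + i.+2 by lia.
by rewrite nthl /= nth_iota //; lia.
Qed.

(** Reading through [tau], the inverse of the pattern, sorts exactly the words ordered like the
    pattern; in a sorted list the rank of an entry is its index plus one. *)
Lemma std_transp_pattern v : size v = m ->
  (std v == sigma) = sorted ltn [seq nth 0 v p | p <- tau].
Proof.
move=> szv.
have sz_std : size (std v) = m by rewrite size_map.
have nth_std p : p < m -> nth 0 (std v) p = count (fun y => y <= nth 0 v p) v.
  by move=> pm; rewrite (nth_map 0) ?szv.
apply/eqP/idP => [stdE | srt].
  have : sorted ltn [seq nth 0 (std v) p | p <- tau].
    by rewrite stdE transp_pattern_positions iota_ltn_sorted.
  rewrite !sorted_map; apply: (@sub_in_sorted _ (fun p => p < m)) => [p q pm qm|].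
    rewrite /= !nth_std // ltnNge => /negP lt_pq; rewrite ltnNge; apply/negP => le_qp.
    by apply: lt_pq; apply: sub_count => y /leq_trans; apply.
  by apply/allP => p; rewrite mem_positions.
have perm_v : perm_eq [seq nth 0 v p | p <- tau] v.
  rewrite -[X in perm_eq _ X](mkseq_nth 0) /mkseq szv.
  exact: perm_map perm_positions.
have E : [seq nth 0 (std v) p | p <- tau] = [seq nth 0 sigma p | p <- tau].
  rewrite transp_pattern_positions.
  apply: (@eq_from_nth _ 0); first by rewrite size_map size_iota size_positions.
  move=> i; rewrite size_map size_positions => im.
  rewrite nth_iota // (nth_map 0) ?size_positions // nth_std; last first.
    by rewrite -mem_positions mem_nth ?size_positions.
  rewrite -(seq.permP perm_v) -(nth_map 0 0 (nth 0 v)) ?size_positions //.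
  by rewrite count_leq_sorted // size_map size_positions.
apply: (@eq_from_nth _ 0); first by rewrite sz_std size_transp_pattern.
move=> i; rewrite sz_std -mem_positions => /(nthP 0)[j]; rewrite size_positions => jm <-.
by rewrite -!(nth_map 0 0 (nth 0 _)) ?size_positions // E.
Qed.

(* An occurrence, at its beginning, of transp_pattern m a in the              *)
(* standardization of the word w.                                             *)
Definition occ0 (w : seq nat) : bool := (m <= size w) && sorted (prec w) tau.

Definition nocc (w : seq nat) : nat :=
  count (fun j => occ0 (drop j w)) (iota 0 (size w)).

Lemma prec_drop w j p q : prec (drop j w) p q = prec w (j + p) (j + q).
Proof. by rewrite /prec !nth_drop !ltn_add2l. Qed.

Lemma occ_nocc o w : size o = size w ->
  {in gtn (size w) &, prec w =2 relpre (nth 0 o) ltn} -> occ sigma o = nocc w.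
Proof.
move=> szo ow; rewrite /occ /nocc size_transp_pattern szo.
have E : size w = (size w).+1 - m + (size w - ((size w).+1 - m)) by lia.
(* [nocc] also tries the starts too close to the end, where [occ0] fails for lack of letters. *)
rewrite [in iota 0 (size w)]E iotaD count_cat [X in _ = _ + X](_ : _ = 0) ?addn0; last first.
  apply/eqP; rewrite -leqn0 leqNgt -has_count; apply/hasPn => j.
  by rewrite mem_iota /occ0 size_drop => ?; rewrite negb_and; apply/orP; left; lia.
apply: eq_in_count => j; rewrite mem_iota add0n => /andP[_ jlt].
have jm : j + m <= size w by lia.
rewrite std_transp_pattern ?size_take ?size_drop ?szo; last by case: ifP => ?; lia.
have -> : occ0 (drop j w) = sorted (prec (drop j w)) tau.
  by rewrite /occ0 size_drop leq_subRL ?jm // (leq_trans _ jm) ?leq_addr.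
rewrite sorted_map.
apply: (@eq_in_sorted _ (fun p => p < m)) => [p q pm qm|]; last first.
  by apply/allP => p; rewrite mem_positions.
rewrite /= prec_drop ow ?inE /=; [|by apply: leq_trans jm; rewrite ltn_add2l..].
by rewrite !nth_take // !nth_drop.
Qed.

End Patterns.

Section Permutations.
Variable n : nat.
Implicit Types p : 'S_n.

Lemma oneline_image_word p : oneline p = map S (image_word p).
Proof. by rewrite /image_word -map_comp. Qed.

(** The sortedness hypothesis thus expresses that [p] is the standardization of [w]. *)
Lemma sorted_image_word w p : sorted (prec w) (image_word p^-1%g) ->
  {in gtn n &, prec w =2 relpre (nth 0%N (oneline p)) ltn}.
Proof.
move=> srt; have mono (i j : 'I_n) : (p i < p j)%N -> prec w i j.
  move=> ltp; have := @sorted_ltn_nth _ _ (@prec_trans w) 0%N _ srt (p i) (p j).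
  by rewrite !inE size_image_word !nth_image_word !permK; apply.
move=> i j; rewrite !inE => /= ilt jlt.
rewrite -[i]/(val (Ordinal ilt)) -[j]/(val (Ordinal jlt)).
move: (Ordinal ilt) (Ordinal jlt) => {ilt jlt} {}i {}j.
rewrite [RHS]/= oneline_image_word !(nth_map 0%N) ?size_image_word //.
rewrite !nth_image_word ltnS.
case: (ltngtP (p i) (p j)) => [/mono // | /mono ji | /val_inj /perm_inj ->].
  by apply/negP => /(prec_trans ji); rewrite prec_irr.
by rewrite prec_irr.
Qed.

Lemma exists_sorted_image_word w : exists p, sorted (prec w) (image_word p^-1%g).
Proof.
pose le := [rel i j | (i == j) || prec w i j].
have le_total : total le.
  by move=> i j /=; have [-> | /(prec_total w) /orP[] ->] := eqVneq i j; rewrite ?orbT ?eqxx.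
have [p ps] : exists p, image_word p = sort le (iota 0 n).
  by apply: image_wordP; rewrite perm_sort.
exists p^-1%g; rewrite invgK.
have := sort_sorted le_total (iota 0 n); rewrite -ps.
case: (image_word p) (uniq_image_word p) => //= x s.
elim: s x => //= y s IH x /andP[]; rewrite inE negb_or => /andP[/negbTE -> _] us /=.
by case/andP=> -> /IH; apply.
Qed.

(** A strict order sorts the positions in only one way, so a single permutation survives in the
    sum. *)
Lemma sum_sorted_image_word (R : comNzRingType) m a (c : R) w :
  (0 < a)%N -> (a < m)%N -> size w = n ->
  \sum_(p : 'S_n) c ^+ occ (transp_pattern m a) (oneline p) *
     (sorted (prec w) (image_word p^-1%g))%:R = c ^+ nocc m a w.
Proof.
move=> a0 am szw; have [p0 srt0] := exists_sorted_image_word w.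
rewrite (bigD1 p0) //= srt0 mulr1 big1 ?addr0 => [|p pp0].
  congr (_ ^+ _); apply: occ_nocc => //; rewrite szw; last exact: sorted_image_word.
  by rewrite oneline_image_word size_map size_image_word.
case srt: (sorted _ _); last by rewrite mulr0.
case/eqP: pp0; apply/invg_inj/image_word_inj.
apply: (irr_sorted_eq (@prec_trans w) (@prec_irr w) srt srt0) => i.
by rewrite !(perm_mem (perm_image_word _)).
Qed.

End Permutations.

(** * Left peaks as descents following ascents *)

Section LeftPeaks.
Local Open Scope nat_scope.

Lemma flags_rcons rho x : flags (rcons rho x) = rcons (flags rho) (last 0 rho <= x).
Proof.
by rewrite /flags -!cats1 pairmap_cat.
Qed.

(** Only the formerly last position can change its status, since it gains a right neighbour. *)
Lemma lpk_rcons w x : lpk (rcons w x) =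
  lpk w + [&& 0 < size w, letter w (size w) > x &
             (size w == 1) || (letter w (size w).-1 < letter w (size w))].
Proof.
rewrite /lpk size_rcons -[(size w).+1]addn1 iotaD count_cat /= addn0.
rewrite [X in _ + nat_of_bool X](_ : _ = false) ?addn0; last first.
  by rewrite /left_peak size_rcons; apply/negbTE; lia.
have [->|wn0] := posnP (size w); first by [].
have -> : iota 1 (size w) = iota 1 (size w).-1 ++ [:: size w].
  by case: (size w) wn0 => // k _; rewrite -{1}[k.+1]addn1 iotaD add1n.
rewrite !count_cat /= !addn0 -addnA.
congr (_ + _).
  apply: eq_in_count => j; rewrite mem_iota => /andP[j0 jlt].
  rewrite /left_peak /letter size_rcons !nth_rcons.
  by repeat (case: ifP => ?; try lia).
rewrite [X in _ = nat_of_bool X + _](_ : _ = false); last by rewrite /left_peak; lia.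
rewrite /left_peak /letter size_rcons !nth_rcons ltnn eqxx /=.
congr nat_of_bool; case: (size w) wn0 => [|[|k]] // _ /=.
  by lia.
by rewrite ltnSn (ltn_trans _ (ltnSn _)) //; lia.
Qed.

Lemma lpk_flags rho : uniq rho -> lpk (map S rho) = peaks (rev (flags rho)).
Proof.
elim/last_ind: rho => // rho x IH; rewrite rcons_uniq => /andP[_ urho].
rewrite map_rcons lpk_rcons flags_rcons rev_rcons /= IH // addnC; congr (nat_of_bool _ + _).
case/lastP: rho urho {IH} => // rho y; rewrite rcons_uniq => /andP[yrho _].
rewrite flags_rcons rev_rcons size_map size_rcons /= last_rcons -ltnNge /letter map_rcons.
rewrite /= !nth_rcons size_map ltnn eqxx ltnS; congr (_ && _).
case: (lastP rho) yrho => // rho' z; rewrite mem_rcons inE negb_or => /andP[yz _].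
rewrite map_rcons !size_rcons /= ltnSn nth_rcons size_map ltnn eqxx ltnS last_rcons.
by rewrite ltn_neqAle eq_sym yz.
Qed.

Lemma ilpk_flags n (p : 'S_n) : ilpk p = peaks (rev (flags (image_word p^-1%g))).
Proof. by rewrite /ilpk oneline_image_word lpk_flags ?uniq_image_word. Qed.

End LeftPeaks.

(** * Overlapping occurrences *)

Definition swap (k x : nat) : nat := (x + (x == k) - (x == k.+1))%N.

Lemma swap_lt k x y : (swap k x < swap k y)%N =
  ((x < y)%N && ~~ ((x == k) && (y == k.+1))) || ((x == k.+1) && (y == k)).
Proof. rewrite /swap; lia. Qed.

Ltac swap_lia := rewrite ?swap_lt ?/swap; lia.

Section Extensions.
Local Open Scope nat_scope.
Implicit Types H : seq nat.

(* Appends the head of an occurrence beginning d positions after the last one. *)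
Definition extend H d : seq nat :=
  H ++ iota (size H) (d - 2) ++ [:: size H + d.-1; size H + d.-2].

Lemma size_extend H d : 1 < d -> size (extend H d) = size H + d.
Proof. by move=> d1; rewrite !size_cat size_iota /=; lia. Qed.

Lemma perm_extend H d : 1 < d -> perm_eq H (iota 0 (size H)) ->
  perm_eq (extend H d) (iota 0 (size (extend H d))).
Proof.
move=> d1 pH; rewrite size_extend //.
have -> : iota 0 (size H + d) =
    iota 0 (size H) ++ iota (size H) (d - 2) ++ [:: size H + d.-2; size H + d.-1].
  have {1}-> : d = d - 2 + 2 by lia.
  rewrite !iotaD /= add0n; congr (_ ++ _ ++ [:: _; _]); lia.
apply: perm_cat => //; rewrite perm_cat2l.
by apply/seq.permP => P; rewrite /= !addn0 addnC.
Qed.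

Lemma flags_cat H s : flags (H ++ s) = flags H ++ pairmap leq (last 0 H) s.
Proof. by rewrite /flags pairmap_cat. Qed.

Lemma pairmap_leq_iota x q n : x <= q -> pairmap leq x (iota q n) = nseq n true.
Proof. by elim: n x q => //= n IH x q xq; rewrite xq IH. Qed.

Lemma peaks_nseq n fl : peaks (nseq n true ++ fl) = peaks fl.
Proof. by elim: n => //= n ->. Qed.

Definition npeaks rho : nat := peaks (rev (flags rho)).

Lemma last_lt_size H : perm_eq H (iota 0 (size H)) -> last 0 H <= size H.
Proof.
case/lastP: H => // H x pH; rewrite last_rcons ltnW //.
by have := perm_mem pH x; rewrite mem_iota mem_rcons mem_head => /esym /andP[].
Qed.

Lemma npeaks_cat_iota H n : perm_eq H (iota 0 (size H)) ->
  npeaks (H ++ iota (size H) n) = npeaks H.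
Proof.
move=> pH; rewrite /npeaks flags_cat pairmap_leq_iota ?last_lt_size //.
by rewrite rev_cat rev_nseq peaks_nseq.
Qed.

Lemma last_iota q n : last q (iota q.+1 n) = q + n.
Proof. by elim: n q => [|n IH] q; rewrite ?addn0 //= IH addnS. Qed.

(** The new entries ascend up to one final descent, so each occurrence of a chain accounts for one
    factor u. *)
Lemma npeaks_extend H d : 1 < d -> perm_eq H (iota 0 (size H)) ->
  npeaks (extend H d) = (npeaks H).+1.
Proof.
move=> d1 pH; rewrite -(npeaks_cat_iota (d - 2) pH) /extend catA /npeaks.
set H1 := H ++ _; rewrite flags_cat.
have -> : pairmap leq (last 0 H1) [:: size H + d.-1; size H + d.-2] = [:: true; false].
  rewrite /=; congr [:: _; _]; last by lia.
  rewrite /H1 last_cat; case E: (d - 2) => [|n] /=.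
    exact: leq_trans (last_lt_size pH) (leq_addr _ _).
  by rewrite last_iota; lia.
by rewrite rev_cat.
Qed.

End Extensions.

Section Overlaps.
Local Open Scope nat_scope.
Variables m a : nat.
Hypotheses (m_ge5 : 5 <= m) (a_ge2 : 2 <= a) (a_le : a <= m - 2).
Notation tau := (positions m a).
Notation b := (m - a.+1).
Implicit Types (r : rel nat) (w H : seq nat).

Let a_gt0 : 0 < a. Proof. exact: ltnW. Qed.
Let a_lt : a < m. Proof. by lia. Qed.

Lemma swapK k : involutive (swap k).
Proof. by move=> x; swap_lia. Qed.

Lemma nth_positions i : i < m -> nth 0 tau i = swap a.-1 i.
Proof.
move=> im; rewrite /positions nth_cat size_iota.
case: ltnP => ia; first by rewrite nth_iota //; swap_lia.
have [->|ne1] := eqVneq i a.-1; first by rewrite subnn /=; swap_lia.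
have [->|ne2] := eqVneq i a; first by have -> : a - a.-1 = 1 by [lia]; rewrite /=; swap_lia.
have -> : i - a.-1 = (i - a.+1).+2 by lia.
by rewrite /= nth_iota; [swap_lia | lia].
Qed.

Lemma sorted_positions r e : transitive r -> sorted r [seq e + p | p <- tau] ->
  forall x y, x < m -> y < m -> swap a.-1 x < swap a.-1 y -> r (e + x) (e + y).
Proof.
move=> tr srt x y xm ym xy.
have lt_swap z : z < m -> swap a.-1 z < m by swap_lia.
have := @sorted_ltn_nth _ _ tr 0 _ srt (swap a.-1 x) (swap a.-1 y).
rewrite !inE size_map size_positions // !lt_swap // => /(_ isT isT xy).
by rewrite !(nth_map 0) ?size_positions ?lt_swap // !nth_positions ?lt_swap // !swapK.
Qed.

Lemma sorted_positionsP r e :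
  (forall x y, x < m -> y < m -> swap a.-1 x < swap a.-1 y -> r (e + x) (e + y)) ->
  sorted r [seq e + p | p <- tau].
Proof.
have lt_swap z : z < m -> swap a.-1 z < m by swap_lia.
move=> H; apply/(sortedP 0) => i; rewrite size_map size_positions // => im.
rewrite !(nth_map 0) ?size_positions ?(ltnW im) // !nth_positions ?(ltnW im) //.
by apply: H; rewrite ?lt_swap ?swapK // ltnW.
Qed.

Definition min_shift : nat := maxn a (m - a).

Lemma occ0_drop w e : occ0 m a (drop e w) =
  (m <= size w - e) && sorted (prec w) [seq e + p | p <- tau].
Proof.
rewrite /occ0 size_drop sorted_map; congr (_ && _); apply: eq_sorted => p q.
exact: prec_drop.
Qed.

Lemma occ0_positions w : occ0 m a w -> sorted (prec w) [seq 0 + p | p <- tau].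
Proof. by rewrite -{1}(drop0 w) occ0_drop => /andP[]. Qed.

(* The descent of each of the two occurrences would be an ascent in the other. *)
Lemma occ0_overlap w d : occ0 m a w -> 0 < d < min_shift -> occ0 m a (drop d w) = false.
Proof.
move=> /occ0_positions /(sorted_positions (@prec_trans w)) h0 /andP[d0 dlt].
apply/negP; rewrite occ0_drop => /andP[_ /(sorted_positions (@prec_trans w)) hd].
have absurd x y : prec w x y -> prec w y x -> False.
  by move=> xy /(prec_trans xy); rewrite prec_irr.
have [da|ad] := ltnP d (m - a).
  apply: (absurd (d + a) (d + a.-1)).
    by apply: hd; swap_lia.
  by apply: (h0 (d + a.-1) (d + a)); swap_lia.
apply: (absurd a a.-1).
  by apply: (h0 a a.-1); swap_lia.
have -> : a.-1 = d + (a.-1 - d) by rewrite /min_shift in dlt; lia.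
have {2}-> : a = d + (a - d) by rewrite /min_shift in dlt; lia.
by apply: hd; move: dlt; rewrite /min_shift ; swap_lia.
Qed.

Lemma extendE H d : 1 < d ->
  extend H d ++ iota (size (extend H d)) b =
  H ++ [seq size H + swap d.-2 x | x <- iota 0 (d + b)].
Proof.
move=> d1; rewrite size_extend // /extend -!catA; congr (_ ++ _).
apply: (@eq_from_nth _ 0); rewrite ?size_map !size_cat /= !size_iota; first by lia.
move=> i ilt; rewrite (nth_map 0) ?size_iota; last by lia.
rewrite nth_iota ?add0n; last by lia.
rewrite nth_cat size_iota; case: ltnP => id2.
  by rewrite nth_iota //; swap_lia.
have [->|ne1] := eqVneq i d.-2.
  by have -> : d.-2 - (d - 2) = 0 by [lia]; rewrite /=; swap_lia.
have [->|ne2] := eqVneq i d.-2.+1.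
  by have -> : d.-2.+1 - (d - 2) = 1 by [lia]; rewrite /=; swap_lia.
have -> : i - (d - 2) = (i - d).+2 by lia.
by rewrite /= nth_iota; swap_lia.
Qed.

(* H lists the positions of the first size H letters, its last two entries    *)
(* being the descent of the last occurrence so far; the b remaining positions *)
(* of that occurrence are increasing.                                         *)
Definition cluster_head H : Prop :=
  [/\ a < size H, perm_eq H (iota 0 (size H)),
      exists H0, H = H0 ++ [:: (size H).-1; (size H).-2] &
      forall r, transitive r -> sorted r (H ++ iota (size H) b) ->
        sorted r [seq size H - a.+1 + p | p <- tau]].

Lemma extend_sorted H d r : transitive r -> cluster_head H -> min_shift <= d < m ->
  let e := size H + d - a.+1 in
  sorted r (extend H d ++ iota (size (extend H d)) b) =
  sorted r (H ++ iota (size H) b) && sorted r [seq e + p | p <- tau].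
Proof.
move=> tr [aH pH [H0 EH] _] /andP[dge dlt] e.
(* Here [5 <= m] enters: the larger of a and m - a is at least 3, so the swap at [d.-2] fixes 0 and
   [T] starts with q. *)
have [d3 [dge1 dge2]] : 3 <= d /\ a <= d /\ m - a <= d by move: dge; rewrite /min_shift; lia.
rewrite extendE; last by lia.
set q := size H in EH aH pH e *.
set T := [seq q + swap d.-2 x | x <- iota 0 (d + b)].
have szT : size T = d + b by rewrite size_map size_iota.
have nthT i : i < d + b -> nth 0 T i = q + swap d.-2 i.
  by move=> ilt; rewrite (nth_map 0) ?size_iota // nth_iota.
have lt_swap z : z < d + b -> swap d.-2 z < d + b by swap_lia.
have Hcat X : sorted r (H ++ X) = sorted r H && path r q.-2 X.
  rewrite EH -catA /=; case: H0 {EH} => [|x H0] /=; first by rewrite andbT.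
  by rewrite !cat_path /= andbT !andbA.
have rH : sorted r H -> r q.-1 q.-2.
  by rewrite EH => /cat_sorted2[_] /=; rewrite andbT.
rewrite !Hcat -andbA; case srtH: (sorted r H) => //=; move/rH in srtH.
apply/idP/andP => [srtT | [/(pathP 0) h1 h2]].
  have lt_head x : x < d + b -> r q.-2 (q + x).
    move=> xlt; have /allP := order_path_min tr srtT; apply.
    by rewrite -[x](swapK d.-2) -nthT ?lt_swap // mem_nth ?szT ?lt_swap.
  have lt_T x y : x < d + b -> y < d + b -> swap d.-2 x < swap d.-2 y -> r (q + x) (q + y).
    move=> xlt ylt xy; have := @sorted_ltn_nth _ _ tr 0 _ (path_sorted srtT) _ _ _ _ xy.
    by rewrite !inE szT !nthT ?lt_swap // !swapK; apply.
  split.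
    apply/(pathP 0) => -[|i]; rewrite size_iota => ilt /=; rewrite !nth_iota ?(ltnW ilt) //.
      by apply: lt_head; lia.
    by apply: lt_T; swap_lia.
  apply: sorted_positionsP => x y xm ym xy.
  have [eq|qe] := leqP q e.
    have -> : e + x = q + (e - q + x) by lia.
    have -> : e + y = q + (e - q + y) by lia.
    by apply: lt_T; move: xy; rewrite /e; swap_lia.
  (* Now d = a: the new occurrence starts at q.-1, which the final descent of [H] puts before q.-2,
     hence before all of [T]. *)
  have Ee : e.+1 = q by rewrite /e in qe *; lia.
  have y0 : 0 < y by move: xy; rewrite /e in qe Ee; swap_lia.
  have -> : e + y = q + y.-1 by lia.
  have [->|x0] := posnP x.
    by apply: (tr q.-2); [have -> : e + 0 = q.-1 by [lia]; done | apply: lt_head; lia].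
  have -> : e + x = q + x.-1 by lia.
  by apply: lt_T; move: xy; rewrite /e in qe Ee; swap_lia.
have {}h2 := sorted_positions tr h2.
have Ee : e + a.+1 = q + d by rewrite /e; lia.
have h2' x y : e <= x < e + m -> e <= y < e + m ->
    ((x < y) && (y != e + a)) || (x < e + a.-1) && (y == e + a) ||
      ((x == e + a) && (y == e + a.-1)) -> r x y.
  move=> xe ye xy; have -> : x = e + (x - e) by lia.
  have -> : y = e + (y - e) by lia.
  by apply: h2; [lia | lia | rewrite swap_lt; clear -xe ye xy a_gt0; lia].
have b0 : 0 < b by lia.
apply/(pathP 0) => -[|i]; rewrite szT => ilt.
  have := h1 0; rewrite size_iota nthT //= nth_iota // => /(_ b0).
  by have -> : swap d.-2 0 = 0 by swap_lia.
rewrite nthT // [nth 0 (_ :: _) _]/= nthT ?(ltnW ilt) //.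
(* Neighbours inside the old tail and before the new descent are compared by [h1]; all others lie
   within the new occurrence. *)
have [ib|bi] := boolP ((i.+1 < b) && (i.+1 < d.-2)).
  have := h1 i.+1; rewrite size_iota /= !nth_iota; [|by lia..].
  have -> : swap d.-2 i = i by swap_lia.
  have -> : swap d.-2 i.+1 = i.+1 by swap_lia.
  by apply; lia.
have swap_id x : x != d.-2 -> x != d.-2.+1 -> swap d.-2 x = x by swap_lia.
have swapl : swap d.-2 d.-2 = d.-2.+1 by swap_lia.
have swapr : swap d.-2 d.-2.+1 = d.-2 by swap_lia.
clear -h2' swap_id swapl swapr Ee d3 dge1 dge2 dlt a_ge2 ilt bi a_lt.
have [E1|n1] := eqVneq i.+1 d.-2; first by rewrite E1 swapl swap_id; try apply: h2'; lia.
have [E2|n2] := eqVneq i d.-2; first by rewrite E2 swapl swapr; apply: h2'; lia.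
have [E3|n3] := eqVneq i d.-2.+1; first by rewrite E3 swapr swap_id; try apply: h2'; lia.
by rewrite !swap_id //; apply: h2'; lia.
Qed.

Lemma cluster_head_extend H d : cluster_head H -> min_shift <= d < m ->
  cluster_head (extend H d).
Proof.
move=> hH dP; have d3 : 3 <= d by move: dP; rewrite /min_shift; lia.
have [aH pH _ _] := hH.
split; first by rewrite size_extend; lia.
- by apply: perm_extend => //; lia.
- exists (H ++ iota (size H) (d - 2)); rewrite -catA size_extend; last by lia.
  by congr (_ ++ _ ++ [:: _; _]); lia.
move=> r tr; rewrite extend_sorted // => /andP[_].
by rewrite size_extend //; lia.
Qed.

(** The first occurrence is viewed as an extension of the empty list, so that [perm_extend] and
    [npeaks_extend] cover it. *)
Definition head0 : seq nat := extend [::] a.+1.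

Lemma size_head0 : size head0 = a.+1.
Proof. by rewrite size_extend. Qed.

Lemma head0E : head0 ++ iota (size head0) b = tau.
Proof. by rewrite size_head0 /head0 /extend /positions /= !add0n subSS subn1 -catA. Qed.

Lemma cluster_head0 : cluster_head head0.
Proof.
split; rewrite ?size_head0 //.
- by rewrite -size_head0; apply: perm_extend.
- exists (iota 0 a.-1); rewrite /head0 /extend /= !add0n subSS subn1.
  by congr (_ ++ [:: _; _]); lia.
have -> : head0 ++ iota a.+1 b = tau by rewrite -head0E size_head0.
move=> r _; rewrite subnn.
by rewrite (eq_map (fun p => add0n p)) map_id.
Qed.

End Overlaps.

(** * The cluster recursion *)

Section Clusters.
Variables (R : comUnitRingType) (c : R) (m a : nat).
Hypotheses (m_ge5 : (5 <= m)%N) (a_ge2 : (2 <= a)%N) (a_le : (a <= m - 2)%N).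
Notation b := (m - a.+1)%N.
Notation shift0 := (min_shift m a).
Implicit Types (w H : seq nat).

Definition wt w : R := c ^+ nocc m a w.
(** The part of [wt w] in which an occurrence at the beginning is marked, without its factor c-1. *)
Definition marked w : R := (occ0 m a w)%:R * wt (behead w).

Lemma wt_behead w : wt w = wt (behead w) + (c - 1) * marked w.
Proof.
case: w => [|x w].
  by rewrite /marked /occ0 leqNgt (leq_trans _ m_ge5) // mul0r mulr0 addr0.
rewrite /marked /wt [behead _]/=.
have -> : nocc m a (x :: w) = (occ0 m a (x :: w) + nocc m a w)%N.
  rewrite /nocc /= ?drop0; congr (_ + _)%N.
  by rewrite (iotaDl 1 0) count_map; apply: eq_count.
by case: (occ0 _ _ _); rewrite /= ?add1n ?add0n ?exprS; ring.
Qed.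

Lemma wt_drop w d1 d2 : (d1 <= d2)%N ->
  wt (drop d1 w) = wt (drop d2 w) + (c - 1) * \sum_(d1 <= d < d2) marked (drop d w).
Proof.
elim: d2 => [|d2 IH]; first by rewrite leqn0 => /eqP ->; rewrite big_geq // mulr0 addr0.
rewrite leq_eqVlt => /predU1P[->|]; first by rewrite big_geq // mulr0 addr0.
rewrite ltnS => le_d; rewrite IH // big_nat_recr //= wt_behead -drop1 drop_drop add1n.
ring.
Qed.

(** Either the next marked occurrence overlaps this one, at a shift allowed by [occ0_overlap], or
    the cluster ends and the word is free from m on. *)
Lemma marked_expand w : marked w = (occ0 m a w)%:R *
  (wt (drop m w) + (c - 1) * \sum_(shift0 <= d < m) marked (drop d w)).
Proof.
rewrite /marked; case occ_w: (occ0 m a w); last by rewrite !mul0r.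
congr (_ * _); rewrite -drop1 (@wt_drop w 1 m); last by lia.
congr (_ + _ * _); rewrite (@big_cat_nat _ _ _ shift0) /min_shift /=; [|lia..].
rewrite big_nat_cond big1 ?add0r // => d; rewrite andbT => /andP[d1 dlt].
by rewrite /marked (occ0_overlap m_ge5 a_ge2 a_le occ_w) ?mul0r // d1.
Qed.

Variable K : nat.

Definition wtsum n : R := wsum K n wt.

(** The sortedness records the chain built so far; [marked] is applied where its last occurrence
    starts. *)
Definition cluster_sum n H : R := wsum K n (fun w =>
  (sorted (prec w) (H ++ iota (size H) b))%:R * marked (drop (size H - a.+1) w)).

Lemma cluster_sum_small n H : (a < size H)%N -> (n < size H + b)%N -> cluster_sum n H = 0.
Proof.
move=> aH nlt; rewrite /cluster_sum /wsum big1 // => w _.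
rewrite /marked /occ0 size_drop size_map size_tuple.
by have -> : (m <= n - (size H - a.+1))%N = false by [lia]; rewrite mul0r mulr0.
Qed.

Lemma wsum_free n H : (0 < K)%N -> perm_eq H (iota 0 (size H)) ->
  wsum K n (fun w => ((size H + b <= size w)%N &&
     sorted (prec w) (H ++ iota (size H) b))%:R * wt (drop (size H + b) w)) =
  if (n < size H + b)%N then 0
  else (nwords K (H ++ iota (size H) b))%:R * wtsum (n - (size H + b)).
Proof.
move=> K0 pH; case: ltnP => [nlt | len].
  rewrite /wsum big1 // => w _; rewrite size_map size_tuple leqNgt nlt.
  by rewrite mul0r.
have pr : perm_eq (H ++ iota (size H) b) (iota 0 (size H + b)).
  by rewrite iotaD perm_cat2r.
rewrite -[in LHS](subnKC len) wsum_cat -(wsum_sorted R K0 pr).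
rewrite mulrC -wsumZ; apply: eq_wsum => u szu; rewrite mulrC -wsumZ.
apply: eq_wsum => v szv; rewrite size_cat szu leq_addr /= drop_size_cat //.
congr (_ %:R * _); congr nat_of_bool.
apply: (@eq_in_sorted _ (fun p => p < size u)%N) => [p q pu qu|].
  by rewrite /prec !nth_cat (pu : (p < _)%N) (qu : (q < _)%N).
by apply/allP => p; rewrite (perm_mem pr) mem_iota szu.
Qed.

(** The chain stops and [wsum_free] applies, or it continues by d and [extend_sorted] merges the
    conditions. *)
Lemma cluster_sum_rec n H : (0 < K)%N -> cluster_head m a H ->
  cluster_sum n H =
    (if (n < size H + b)%N then 0
     else (nwords K (H ++ iota (size H) b))%:R * wtsum (n - (size H + b))) +
    (c - 1) * \sum_(shift0 <= d < m) cluster_sum n (extend H d).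
Proof.
move=> K0 hH; have [aH pH _ lastH] := hH.
rewrite -(wsum_free n K0 pH) /cluster_sum -wsum_sum -wsumZ -wsumD.
apply: eq_wsum => w szw; set e0 := (size H - a.+1)%N.
have Em : (m + e0 = size H + b)%N by rewrite /e0; lia.
case srt: (sorted _ (H ++ _)); last first.
  rewrite andbF !mul0r add0r big_nat_cond big1 ?mulr0 // => d; rewrite andbT => dP.
  by rewrite (extend_sorted m_ge5 a_ge2 a_le (@prec_trans w) hH dP) srt mul0r.
rewrite mul1r andbT marked_expand drop_drop Em.
have -> : occ0 m a (drop e0 w) = (size H + b <= size w)%N.
  rewrite occ0_drop (lastH _ (@prec_trans w) srt) andbT; lia.
rewrite mulrDr mulrCA mulr_sumr; congr (_ + _ * _).
apply: eq_big_nat => d dP; rewrite drop_drop.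
rewrite (extend_sorted m_ge5 a_ge2 a_le (@prec_trans w) hH dP) srt /=.
rewrite size_extend; last by move: dP; rewrite /min_shift; lia.
have -> : (d + e0 = size H + d - a.+1)%N by rewrite /e0; lia.
case occ_d: (occ0 m a (drop (size H + d - a.+1) w)); last first.
  by rewrite /marked occ_d mul0r !mulr0.
move: (occ_d); rewrite occ0_drop => /andP[le_m ->].
by congr (_%:R * _); rewrite (_ : (_ <= _)%N = true) //; move: dP; rewrite /min_shift; lia.
Qed.

Lemma wtsum0 : wtsum 0 = 1.
Proof. by rewrite /wtsum wsum0. Qed.

Lemma wtsumS n : wtsum n.+1 = K%:R * wtsum n + (c - 1) * cluster_sum n.+1 (head0 a).
Proof.
have -> : K%:R * wtsum n = wsum K n.+1 (fun w => wt (behead w)).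
  by rewrite wsumS /= sumr_const card_ord mulr_natl.
rewrite /cluster_sum head0E // size_head0 // subnn -wsumZ -wsumD; apply: eq_wsum => w _.
rewrite drop0 wt_behead; congr (_ + _ * _).
rewrite /marked /occ0; case: (sorted _ _); rewrite ?andbF ?andbT ?mul1r ?mul0r //.
Qed.

End Clusters.

(** * Generating functions *)

Section Convergence.
Variable R : comUnitRingType.
Notation xtser := (fps (fps R)).
Implicit Types (F : nat -> xtser) (S g : xtser).

(* The n-th partial sum agrees with S up to x^n; unlike has_sum, this is      *)
(* uniform in the degree of t.                                                *)
Definition xsum F S := forall j k n, (k < n)%N ->
  fcoef (fcoef (\sum_(0 <= l < n) F l) j) k = fcoef (fcoef S j) k.

Lemma xsum_has_sum F S : xsum F S -> has_sum F S.
Proof. by move=> FS j k; exists k.+1 => n kn; apply: FS. Qed.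

Lemma xsum_mull g F S : xsum F S -> xsum (fun n => g * F n) (g * S).
Proof.
move=> FS j k n kn; rewrite -mulr_sumr !fcoefM !fcoef_sum.
apply: eq_bigr => i _; rewrite !fcoefM; apply: eq_bigr => l _.
by rewrite FS // (leq_ltn_trans (leq_subr _ _) kn).
Qed.

End Convergence.

Section HadamardPowers.
Variable A : comUnitRingType.

Lemma fcoef_geometric j : fcoef (1 - fpsX A)^-1 j = 1.
Proof.
have -> : (1 - fpsX A)^-1 = Fps (fun=> 1).
  apply: (mulrI (unit_1BX A)); rewrite mulrV ?unit_1BX //.
  apply: fpsP => n; rewrite mulrBl mul1r fcoefD fcoefN fcoefXM fcoef1.
  by case: n => [|n]; rewrite /= ?subr0 ?subrr.
by [].
Qed.

Lemma fcoef_hadamard_pow (f : fps A) n j :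
  fcoef (hadamard_pow f n) j = fcoef f j ^+ n.
Proof.
elim: n => [|n IH]; first by rewrite expr0 -[RHS](fcoef_geometric j).
by rewrite exprS -IH.
Qed.

End HadamardPowers.

Section MainIdentity.
Variables (R : comUnitRingType) (c : R) (m a : nat).
Hypotheses (m_ge5 : (5 <= m)%N) (a_ge2 : (2 <= a)%N) (a_le : (a <= m - 2)%N).
Notation b := (m - a.+1)%N.
Notation shift0 := (min_shift m a).
Notation A := (fps R).
Notation t := (ts R).
Notation u := (us R).
Notation z := (zs R).
Notation s := (scal c).

Lemma zsX n : z ^+ n = xs R ^+ n * letter_ser A ^+ n.
Proof. by rewrite -exprMn; congr (_ ^+ _); rewrite /zs (mulrC (1 + ts R)) -mulrA. Qed.

Lemma fcoef_xsM n (f : fps A) k : fcoef (xs R ^+ n * f) k = fpsX R ^+ n * fcoef f k.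
Proof. by rewrite /xs -rmorphXn fcoefCM. Qed.

Definition cluster_den : fps A := 1 - (s - 1) * u * \sum_(shift0 <= d < m) z ^+ d.

Definition cluster_term N r : fps A := u ^+ r * z ^+ N / (1 - t).

Definition cluster_ser N r : fps A := cluster_term N r / cluster_den.

Lemma unit_cluster_den : cluster_den \is a GRing.unit.
Proof. by rewrite /cluster_den -!mulNr unit_1Dus. Qed.

Lemma cluster_ser_rec N r : cluster_ser N r =
  cluster_term N r + (s - 1) * \sum_(shift0 <= d < m) cluster_ser (N + d) r.+1.
Proof.
apply: (mulIr unit_cluster_den); rewrite [LHS](divrK unit_cluster_den).
rewrite mulrDl -[(s - 1) * _ * _]mulrA mulr_suml.
rewrite (eq_bigr (fun d => cluster_term N r * u * z ^+ d)); last first.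
  move=> d _; rewrite (divrK unit_cluster_den) /cluster_term exprS exprD.
  by move: (1 - t)^-1 (z) (u) => v x y; ring.
rewrite -mulr_sumr /cluster_den; ring.
Qed.

Lemma fcoef_cluster_term k rho : fcoef (cluster_term (size rho) (npeaks rho)) k =
  fpsX R ^+ size rho * fpsC (nwords k.*2.+1 rho)%:R.
Proof.
rewrite /cluster_term zsX mulrCA -mulrA fcoef_xsM rmorph_nat -fcoef_nwords.
by rewrite (mulrC (u ^+ _)).
Qed.

Lemma fcoef_s1M (f : fps A) k : fcoef ((s - 1) * f) k = fpsC (c - 1) * fcoef f k.
Proof. by rewrite /scal -!(rmorph1 (@fpsC _)) -!rmorphB fcoefCM. Qed.

Definition word_ser k : A := Fps (wtsum c m a k.*2.+1).

(** Both sides obey the same recursion ([cluster_sum_rec], [cluster_ser_rec]), and both vanish once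
    the chain is longer than n. *)
Lemma cluster_sumE k n H : cluster_head m a H ->
  cluster_sum c m a k.*2.+1 n H =
  fcoef (fcoef (cluster_ser (size H + b) (npeaks H)) k * word_ser k) n.
Proof.
have [j] := ubnP (n.+1 - (size H + b)).
elim: j H => // j IH H; rewrite ltnS => le_j hH; have [aH pH _ _] := hH.
have [nlt|len] := ltnP n (size H + b).
  rewrite cluster_sum_small // /cluster_ser /cluster_term zsX.
  rewrite mulrCA -!mulrA fcoef_xsM -mulrA fcoefXnM nlt //.
have nlt : (n < size H + b)%N = false by rewrite ltnNge len.
rewrite cluster_sum_rec // nlt cluster_ser_rec fcoefD fcoef_s1M [in RHS]mulrDl fcoefD.
congr (_ + _).
  rewrite -(npeaks_cat_iota b pH); set rho := H ++ _.
  have Esz : size rho = (size H + b)%N by rewrite size_cat size_iota.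
  by rewrite -Esz in nlt *; rewrite fcoef_cluster_term -mulrA fcoefXnM nlt fcoefCM.
rewrite -mulrA fcoefCM fcoef_sum mulr_suml fcoef_sum; congr (_ * _).
apply: eq_big_nat => d dP.
have d3 : (2 < d)%N by move: dP; rewrite /min_shift; lia.
rewrite IH; [|rewrite size_extend; lia|exact: cluster_head_extend].
by rewrite (size_extend _ (ltnW d3)) (npeaks_extend (ltnW d3) pH) (addnAC _ d).
Qed.

Definition summand : fps A := z / (1 - t) + (s - 1) * cluster_ser m 1.

Lemma fcoef_summand k : fcoef summand k =
  fpsX R * fpsC k.*2.+1%:R + fpsC (c - 1) * fcoef (cluster_ser m 1) k.
Proof.
rewrite fcoefD fcoef_s1M; congr (_ + _).
(* A one-letter list has no peak, hence no factor u. *)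
have -> : z / (1 - t) = cluster_term (size [:: 0%N]) (npeaks [:: 0%N]).
  by rewrite /cluster_term expr0 mul1r.
rewrite fcoef_cluster_term expr1; congr (_ * fpsC _).
rewrite -(@wsum_sorted R _ 1) // wsumS.
by under eq_bigr => i _ do rewrite wsum0; rewrite sumr_const card_ord.
Qed.

(** Coefficientwise in x this is [wtsumS]. *)
Lemma word_ser_rec k : word_ser k * (1 - fcoef summand k) = 1.
Proof.
rewrite fcoef_summand; apply: fpsP => n.
have E f : (word_ser k * (1 - f)) = word_ser k - f * word_ser k by ring.
rewrite E fcoefD fcoefN mulrDl fcoefD -!mulrA fcoefXM !fcoefCM fcoef1.
have head0P := cluster_head0 m a_ge2.
have <- : cluster_sum c m a k.*2.+1 n (head0 a) =
    fcoef (fcoef (cluster_ser m 1) k * word_ser k) n.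
  have np : npeaks (head0 a) = 1%N by rewrite /head0 npeaks_extend // ltnS ltnW.
  have Em : (a.+1 + b)%N = m by lia.
  by rewrite (cluster_sumE _ _ head0P) (size_head0 a_ge2) np Em.
rewrite [fcoef (word_ser k) n]/=; case: n => [|n].
  rewrite cluster_sum_small ?(size_head0 a_ge2) //.
  by rewrite wtsum0 mulr0 addr0 subr0.
by rewrite (wtsumS c m_ge5 a_ge2) fcoefCM subrr.
Qed.

(** Without constant term in x, the geometric series converges x-adically. *)
Lemma fcoef_summandX k : exists g, fcoef summand k = fpsX R * g.
Proof.
rewrite fcoef_summand /cluster_ser /cluster_term zsX.
have -> : m = m.-1.+1 by lia.
rewrite exprS mulrCA -!mulrA fcoef_xsM exprS mulrCA -!mulrA -mulrDr.
by eexists.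
Qed.

Definition total_ser : fps A := Fps word_ser.

Lemma xsum_hadamard : xsum (hadamard_pow summand) total_ser.
Proof.
move=> j k n kn; rewrite fcoef_sum.
under eq_bigr => l _ do rewrite fcoef_hadamard_pow.
have [g Eg] := fcoef_summandX j; have := word_ser_rec j; move: Eg.
set f := fcoef summand j => Eg Ef.
have -> : \sum_(0 <= l < n) f ^+ l = word_ser j - fpsX R ^+ n * (word_ser j * g ^+ n).
  rewrite big_mkord; have := subrX1 f n.
  move=> /(congr1 (fun h => - word_ser j * h)).
  rewrite Eg exprMn -Eg => E.
  transitivity (word_ser j * (1 - f) * \sum_(i < n) f ^+ i); first by rewrite Ef mul1r.
  transitivity (- word_ser j * ((f - 1) * \sum_(i < n) f ^+ i)); first by ring.
  by rewrite -E; ring.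
by rewrite fcoefD fcoefN fcoefXnM kn subr0.
Qed.

(** Exchanging the sums over permutations and words leaves each word with the weight of its
    standardization. *)
Lemma fcoef_P_ilpk n k :
  fcoef (1 / (1 - t) * (P_ilpk (transp_pattern m a) n s u * z ^+ n)) k =
  fpsX R ^+ n * fpsC (wtsum c m a k.*2.+1 n).
Proof.
rewrite /P_ilpk; case: eqVneq => [-> | n0].
  by rewrite !(expr0, mulr1, mul1r) fcoef_geometric wtsum0 rmorph1.
rewrite mulr_suml mulr_sumr fcoef_sum.
have am : (a < m)%N by lia.
have a0 : (0 < a)%N by exact: ltnW.
transitivity (\sum_(p : 'S_n) fpsX R ^+ n *
   fpsC (c ^+ occ (transp_pattern m a) (oneline p) *
     (nwords k.*2.+1 (image_word p^-1%g))%:R)).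
  apply: eq_bigr => p _; rewrite ilpk_flags.
  transitivity (fcoef (s ^+ occ (transp_pattern m a) (oneline p) *
     cluster_term (size (image_word p^-1%g)) (npeaks (image_word p^-1%g))) k).
    by congr fcoef; rewrite size_image_word /cluster_term /npeaks mul1r; ring.
  rewrite /scal -!rmorphXn fcoefCM fcoef_cluster_term size_image_word.
  by rewrite rmorphM /= mulrCA.
rewrite -mulr_sumr -rmorph_sum; congr (_ * fpsC _).
rewrite (eq_bigr (fun p : 'S_n => wsum k.*2.+1 n (fun w =>
   c ^+ occ (transp_pattern m a) (oneline p) * (sorted (prec w) (image_word p^-1%g))%:R))).
  rewrite -wsum_sum; apply: eq_wsum => w szw.
  exact: sum_sorted_image_word.
by move=> p _; rewrite wsumZ (wsum_sorted _ _ (perm_image_word _)).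
Qed.

Lemma xsum_P_ilpk :
  xsum (fun n => 1 / (1 - t) * (P_ilpk (transp_pattern m a) n s u * z ^+ n)) total_ser.
Proof.
move=> j k n kn; rewrite !fcoef_sum.
under eq_bigr => l _ do rewrite fcoef_P_ilpk mulrC fcoefCM.
rewrite big_mkord (bigD1 (Ordinal kn)) //= -[fpsX R ^+ k]mulr1 fcoefXnM ltnn subnn.
rewrite fcoef1 mulr1 big1 ?addr0 // => l lk.
rewrite -[fpsX R ^+ l]mulr1 fcoefXnM fcoef1; case: ltnP => [_|le]; first by rewrite mulr0.
rewrite (_ : (k - l == 0)%N = false) ?mulr0 //.
apply/negbTE; apply: contraNneq lk => kl; apply/eqP/val_inj => /=; lia.
Qed.

Theorem P_ilpk_identity :
  let L := fun n => P_ilpk (transp_pattern m a) n s u * z ^+ n in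
  [/\ summable L, summable (hadamard_pow summand) &
      1 / (1 - t) * infsum L = infsum (hadamard_pow summand)].
Proof.
move=> L.
(* [xsum_P_ilpk] includes the factor 1/(1-t) in each term; it is cancelled here to sum [L]
   itself. *)
have LS : has_sum L ((1 - t) * total_ser).
  apply: xsum_has_sum => j k n kn; rewrite -(xsum_mull (1 - t) xsum_P_ilpk j kn).
  congr (fcoef (fcoef _ j) k); apply: eq_bigr => l _.
  by rewrite mulrA mul1r mulrV ?unit_1Bts // mul1r.
have RS := xsum_has_sum xsum_hadamard.
split; [by exists ((1 - t) * total_ser) | by exists total_ser |].
by rewrite (infsumE LS) (infsumE RS) mul1r mulKr ?unit_1Bts.
Qed.

(** The shift d is replaced by the length l = m - d of the overlap. *)
Lemma shift_sum : \sum_(shift0 <= d < m) z ^+ d =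
  \sum_(1 <= l < (minn a (m - a)).+1) z ^+ (m - l).
Proof.
rewrite big_nat_rev -[shift0 in LHS]add0n -[1%N in RHS]add0n !big_addn.
have -> : (m - shift0 = (minn a (m - a)).+1 - 1)%N by rewrite /min_shift; lia.
by apply: eq_big_nat => l _; congr (_ ^+ _); lia.
Qed.

Lemma summandE : summand = z / (1 - t) + (s - 1) * u * z ^+ m /
  ((1 - t) * (1 - (s - 1) * u * \sum_(1 <= l < (minn a (m - a)).+1) z ^+ (m - l))).
Proof.
rewrite -shift_sum.
have inv_mul : ((1 - t) * cluster_den)^-1 = (1 - t)^-1 / cluster_den.
  by rewrite (invrM (unit_1Bts R) unit_cluster_den) mulrC.
by rewrite inv_mul /summand /cluster_ser /cluster_term expr1 !mulrA.
Qed.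

End MainIdentity.

Lemma P0_ilpk_identity (R : comUnitRingType) (m a : nat) :
    (5 <= m)%N -> (2 <= a)%N -> (a <= m - 2)%N ->
  let t := ts R in let u := us R in let z := zs R in
  let L := fun n => P0_ilpk (transp_pattern m a) n u * z ^+ n in
  let f := z / (1 - t) - u * z ^+ m / ((1 - t) *
     (1 + u * \sum_(1 <= l < (minn a (m - a)).+1) z ^+ (m - l))) in
  [/\ summable L, summable (hadamard_pow f) &
      1 / (1 - t) * infsum L = infsum (hadamard_pow f)].
Proof.
move=> m5 a2 am t u z L f; have := P_ilpk_identity (0 : R) m5 a2 am.
have scal0 : scal (0 : R) = 0 by rewrite /scal !rmorph0.
have -> : summand (0 : R) m a = f.
  by rewrite (summandE _ m5 a2 am) scal0 sub0r !mulN1r !mulNr opprK.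
by rewrite scal0.
Qed.

Theorem theorem5p4 (m a : nat) (hm : (5 <= m)%N)
    (ha : (2 <= a)%N) (ham : (a <= m - 2)%N) :
  let sigma := transp_pattern m a in
  let i := minn a (m - a) in
  (let t := ts {poly rat} in
   let s := scal ('X : {poly rat}) in
   let u := us {poly rat} in
   let z := zs {poly rat} in
   let L := fun n : nat => P_ilpk sigma n s u * z ^+ n in
   let R := fun n : nat =>
     hadamard_pow
       (z / (1 - t)
        + (s - 1) * u * z ^+ m
          / ((1 - t) * (1 - (s - 1) * u * \sum_(1 <= l < i.+1) z ^+ (m - l)))) n in
   [/\ summable L, summable R & 1 / (1 - t) * infsum L = infsum R])
  /\
  (let t := ts rat in
   let u := us rat in
   let z := zs rat in
   let L := fun n : nat => P0_ilpk sigma n u * z ^+ n in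
   let R := fun n : nat =>
     hadamard_pow
       (z / (1 - t)
        - u * z ^+ m
          / ((1 - t) * (1 + u * \sum_(1 <= l < i.+1) z ^+ (m - l)))) n in
   [/\ summable L, summable R & 1 / (1 - t) * infsum L = infsum R]).
Proof.
move=> sigma i; split=> [t s u z L R | t u z L R].
  (* The formal variable s is the indeterminate of the coefficient ring. *)
  have := P_ilpk_identity ('X : {poly rat}) hm ha ham.
  by rewrite (summandE _ hm ha ham).
exact: P0_ilpk_identity hm ha ham.
Qed.
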